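(* Let $X=(V,E)$ be a $d$-dimensional topological crystal over a finite connected graph $X_0$, and let $\varPhi:X\longrightarrow\mathbb{R}^d$ be an injective periodic realization with period lattice $\rho(L)$. Let $\Gamma$ be a group of congruence transformations of $\mathbb{R}^d$ that preserves $\varPhi(X)$ and contains (the translations by) the period lattice $\rho(L)$; then $\Gamma$ is a crystallographic group, and we let $K\subset O(d)$ be its point group. Suppose that (1) the action of $K$ on $\mathbb{R}^d$ is irreducible, and (2) for every vertex $x\in V$, the only vector of $\mathbb{R}^d$ fixed by the isotropy group $\Gamma_{\varPhi(x)}$ is ${\bf 0}$, i.e. $\{{\bf u}\in\mathbb{R}^d\mid g{\bf u}={\bf u}\ (g\in\Gamma_{\varPhi(x)})\}=\{{\bf 0}\}$, where $\Gamma_{\varPhi(x)}$ is regarded as a subgroup of $K\subset O(d)$ acting linearly on $\mathbb{R}^d$. Then $\varPhi$ is a standard realization of $X$.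
   Context: Graphs. A graph $X=(V,E)$ has vertex set $V$ and set $E$ of directed edges (each edge is counted with both its directions); $o(e)$, $t(e)$, $\overline{e}$ denote the origin, terminus and inverse of $e$. Loops and multiple edges are allowed. $E_x$ is the set of $e\in E$ with $o(e)=x$. Throughout, every vertex is assumed to have degree $|E_x|\ge 3$. Graphs are regarded as 1-dimensional cell complexes. Homology. Let $X_0=(V_0,E_0)$ be a finite connected graph. $C_1(X_0,\mathbb{R})$ is the group of 1-chains (with $\overline{e}=-e$), with inner product $\langle e,e'\rangle=1$ if $e'=e$, $-1$ if $e'=\overline{e}$, $0$ otherwise. $H_1(X_0,\mathbb{R})=\ker\partial\subset C_1(X_0,\mathbb{R})$, where $\partial e=t(e)-o(e)$, carries the induced inner product. $P_0:C_1(X_0,\mathbb{R})\to H_1(X_0,\mathbb{R})$ is the orthogonal projection and ${\bf v}_0(e)=P_0(e)$. Topological crystals. $X_0^{\rm ab}$ is the maximal abelian covering graph of $X_0$ (covering transformation group $H_1(X_0,\mathbb{Z})$). A $d$-dimensional topological crystal over $X_0$ is an abelian covering graph $X=(V,E)$ of $X_0$ whose covering transformation group $L$ is free abelian of rank $d$; equivalently $X=X_0^{\rm ab}/H$ for a direct summand $H$ of $H_1(X_0,\mathbb{Z})$ (the vanishing subgroup) with $H_1(X_0,\mathbb{Z})/H=L$. Realizations. A periodic realization of $X$ is a piecewise linear map $\varPhi:X\to\mathbb{R}^d$ (each edge is mapped affinely to a segment) such that $\varPhi(\sigma x)=\varPhi(x)+\rho(\sigma)$ for $\sigma\in L$, where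 $\rho:L\to\mathbb{R}^d$ is an injective homomorphism whose image is a lattice, called the period lattice. Its building cochain is ${\bf v}(e)=\varPhi(t(e))-\varPhi(o(e))$, an $L$-invariant function on $E$, hence a function on $E_0$; it determines $\varPhi$ up to translation. Standard realizations. Let $H_{\mathbb{R}}^{\perp}$ be the orthogonal complement in $H_1(X_0,\mathbb{R})$ of the span $H_{\mathbb{R}}$ of $H$; it has dimension $d$ and is identified with $\mathbb{R}^d$ by choosing an orthonormal basis. With $P:H_1(X_0,\mathbb{R})\to H_{\mathbb{R}}^{\perp}$ the orthogonal projection, the realization with building cochain ${\bf v}(e)=P({\bf v}_0(e))$ is the normalized standard realization of $X$. A standard realization is one obtained from the normalized one by composing with a similarity transformation of $\mathbb{R}^d$. Crystallographic groups. A congruence transformation is an isometry ${\bf x}\mapsto A{\bf x}+{\bf b}$, $A\in O(d)$. A crystallographic group is a discrete co-compact group $\Gamma$ of such isometries; its point group $K\subset O(d)$ is the image of $\Gamma$ under $({\bf x}\mapsto A{\bf x}+{\bf b})\mapsto A$. The isotropy group $\Gamma_{\bf p}=\{g\in\Gamma\mid g{\bf p}={\bf p}\}$ is identified with its (injective) image in $K$. *)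

(* Defs.v *)
From HB Require Import structures.
From mathcomp Require Import all_boot all_order all_algebra.
From mathcomp Require Import all_classical all_reals all_analysis.
Set Implicit Arguments.
Unset Strict Implicit.
Unset Printing Implicit Defensive.
Import Order.TTheory GRing.Theory Num.Theory.
Import numFieldNormedType.Exports.
Local Open Scope classical_set_scope.
Local Open Scope ring_scope.

(** * Graphs *)

(* Every edge occurs with both directions; loops and multiple edges are
   allowed, but an edge is never its own inverse. *)
Record graph (V E : Type) := Graph {
  org : E -> V;
  ter : E -> V;
  inv : E -> E;
  inv_invol : forall e, inv (inv e) = e;
  inv_neq : forall e, inv e <> e;
  org_inv : forall e, org (inv e) = ter e }.

Section Graphs.
Variables (V E : Type) (G : graph V E).

Definition degree_ge (k : nat) :=
  forall x, exists f : 'I_k -> E, injective f /\ forall i, org G (f i) = x.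

Fixpoint walk (x : V) (p : seq E) (y : V) : Prop :=
  if p is e :: p' then org G e = x /\ walk (ter G e) p' y else x = y.

Definition connected_graph :=
  inhabited V /\ forall x y, exists p, walk x p y.

(* The 1-dimensional cell complex of [G]: since every vertex will have an
   incident edge, its points are the pairs (e, s) with 0 <= s <= 1, where s is
   the position on e measured from the origin, up to [same_point]. *)
Variable R : realType.

Definition on_edge (p : E * R) : Prop := 0 <= p.2 <= 1.

Definition at_vertex (p : E * R) (x : V) :=
  (p.2 = 0 /\ org G p.1 = x) \/ (p.2 = 1 /\ ter G p.1 = x).

Definition same_point (p q : E * R) :=
  [\/ p = q,
      q = (inv G p.1, 1 - p.2)
    | exists x, at_vertex p x /\ at_vertex q x].

End Graphs.

(** * Real homology of a finite graph *)

Section Chains.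
Variables (V0 E0 : finType) (G : graph V0 E0).

(* A 1-chain is represented by the function sending e to the coefficient of e
   when one writes the chain with exactly one of e, inv e for each pair; so the
   chain group is the set of odd functions, and the chain e itself is the
   function taking the value 1 at e, -1 at inv e and 0 elsewhere. *)
Definition edge_chain (K : nzRingType) (e : E0) : {ffun E0 -> K^o} :=
  [ffun e' => (e' == e)%:R - (e' == inv G e)%:R].

Variable R : realType.
Notation C := {ffun E0 -> R^o}.

Definition chains : set C := [set f | forall e, f (inv G e) = - f e].

(* The factors 1/2 below compensate for each geometric edge being summed over
   in both directions: <e, e> = 1, <e, inv e> = -1, and
   boundary e = t(e) - o(e). *)
Definition dotc (f g : C) : R := 2^-1 * \sum_e f e * g e.

Definition boundary (f : C) : {ffun V0 -> R} :=
  [ffun x => 2^-1 * \sum_e f e * ((ter G e == x)%:R - (org G e == x)%:R)].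

Definition homology1 : set C :=
  [set f | chains f /\ boundary f = 0].

Definition lin_span (S : set C) : set C :=
  [set f | exists (n : nat) (c : 'I_n -> R) (h : 'I_n -> C),
             (forall i, S (h i)) /\ f = \sum_i c i *: h i].

Definition orth_in (W S : set C) : set C :=
  [set f | W f /\ forall h, S h -> dotc f h = 0].

(* The orthogonal projection of f onto a linear subspace W, by choice of the
   (unique) w in W with f - w orthogonal to W. *)
Definition orth_proj (W : set C) (f : C) : C :=
  xget 0 [set w | W w /\ forall h, W h -> dotc (f - w) h = 0].

Definition v0 (e : E0) : C := orth_proj homology1 (edge_chain R e).

Definition orthonormal_basis (d : nat) (W : set C) (B : 'I_d -> C) :=
  (forall i j, dotc (B i) (B j) = (i == j)%:R) /\ W = lin_span (range B).

End Chains.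

(** * Topological crystals *)

Definition free_abelian (L : zmodType) (d : nat) :=
  exists b : 'I_d -> L, forall s : L,
    exists! n : {ffun 'I_d -> int}, s = \sum_i b i *~ n i.

(* [tc_V], [tc_E], [tc_graph] is a connected covering graph of [X0], and the
   free abelian group [tc_L] of rank d acts on it by covering transformations,
   simply transitively on every vertex fibre; as the covering is connected,
   [tc_L] is then its whole covering transformation group. *)
Record topological_crystal (V0 E0 : finType) (X0 : graph V0 E0) (d : nat) :=
  TopologicalCrystal {
  tc_V : Type;
  tc_E : Type;
  tc_graph : graph tc_V tc_E;
  tc_connected : connected_graph tc_graph;
  tc_pv : tc_V -> V0;
  tc_pe : tc_E -> E0;
  tc_p_org : forall e, org X0 (tc_pe e) = tc_pv (org tc_graph e);
  tc_p_ter : forall e, ter X0 (tc_pe e) = tc_pv (ter tc_graph e);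
  tc_p_inv : forall e, tc_pe (inv tc_graph e) = inv X0 (tc_pe e);
  tc_p_surj : forall x0, exists x, tc_pv x = x0;
  tc_p_local : forall x e0, org X0 e0 = tc_pv x ->
    exists! e, org tc_graph e = x /\ tc_pe e = e0;
  tc_L : zmodType;
  tc_L_free : free_abelian tc_L d;
  tc_av : tc_L -> tc_V -> tc_V;
  tc_ae : tc_L -> tc_E -> tc_E;
  tc_av0 : forall x, tc_av 0 x = x;
  tc_avD : forall s t x, tc_av (s + t) x = tc_av s (tc_av t x);
  tc_ae0 : forall e, tc_ae 0 e = e;
  tc_aeD : forall s t e, tc_ae (s + t) e = tc_ae s (tc_ae t e);
  tc_a_org : forall s e, org tc_graph (tc_ae s e) = tc_av s (org tc_graph e);
  tc_a_ter : forall s e, ter tc_graph (tc_ae s e) = tc_av s (ter tc_graph e);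
  tc_a_inv : forall s e, tc_ae s (inv tc_graph e) = inv tc_graph (tc_ae s e);
  tc_a_pv : forall s x, tc_pv (tc_av s x) = tc_pv x;
  tc_a_pe : forall s e, tc_pe (tc_ae s e) = tc_pe e;
  tc_a_simply_transitive : forall x y, tc_pv x = tc_pv y ->
    exists! s, tc_av s x = y }.

Definition orthogonal_mx (R : realType) (d : nat) (A : 'M[R]_d) : Prop :=
  A^T *m A = 1%:M.

Section Crystals.
Variables (V0 E0 : finType) (X0 : graph V0 E0) (d : nat).
Variable X : topological_crystal X0 d.

(* The graph of the canonical surjection H_1(X0, Z) -> L: the homology class of
   a closed path of X0 is sent to the covering transformation s such that its
   lift starting at x ends at s x.  Every integral 1-cycle is the class of such
   a path, X0 being connected. *)
Definition holonomy (a : {ffun E0 -> int^o}) (s : tc_L X) :=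
  exists (x : tc_V X) (p : seq (tc_E X)),
    walk (tc_graph X) x p (tc_av s x) /\
    a = \sum_(e <- p) edge_chain X0 int (tc_pe e).

(* H, the kernel of that surjection, for which X = X0^ab / H. *)
Definition vanishing_subgroup : set {ffun E0 -> int^o} :=
  [set a | holonomy a 0].

Variable R : realType.

Definition vanishing_span : set {ffun E0 -> R^o} :=
  lin_span [set [ffun e => (a e)%:~R : R^o] | a in vanishing_subgroup].

Definition vanishing_orth : set {ffun E0 -> R^o} :=
  orth_in (homology1 X0 (R := R)) vanishing_span.

(* A piecewise linear map on X is determined by its values [phi] on vertices;
   [realize phi] is its value at a point (e, s) of the cell complex. *)
Definition realize (phi : tc_V X -> 'cV[R]_d) (p : tc_E X * R) : 'cV[R]_d :=
  (1 - p.2) *: phi (org (tc_graph X) p.1) + p.2 *: phi (ter (tc_graph X) p.1).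

Definition realization_image (phi : tc_V X -> 'cV[R]_d) : set 'cV[R]_d :=
  [set realize phi p | p in @on_edge (tc_E X) R].

Definition injective_realization (phi : tc_V X -> 'cV[R]_d) :=
  forall p q, on_edge p -> on_edge q ->
    realize phi p = realize phi q -> same_point (tc_graph X) p q.

Definition lattice (S : set 'cV[R]_d) :=
  exists B : 'M[R]_d, B \in unitmx /\
    S = [set B *m map_mx intr n | n in [set: 'cV[int]_d]].

Definition periodic_realization (rho : {additive tc_L X -> 'cV[R]_d})
    (phi : tc_V X -> 'cV[R]_d) :=
  [/\ injective rho,
      lattice (range rho)
    & forall s x, phi (tc_av s x) = phi x + rho s].

Definition building_cochain (phi : tc_V X -> 'cV[R]_d) (e : tc_E X) :=
  phi (ter (tc_graph X) e) - phi (org (tc_graph X) e).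

(* [B] is the orthonormal basis identifying the orthogonal complement of H_R
   with R^d. *)
Definition normalized_standard (phi : tc_V X -> 'cV[R]_d) :=
  exists B : 'I_d -> {ffun E0 -> R^o},
    orthonormal_basis vanishing_orth B /\
    forall e, building_cochain phi e =
      \col_i dotc (B i) (orth_proj vanishing_orth (v0 X0 R (tc_pe e))).

Definition standard_realization (phi : tc_V X -> 'cV[R]_d) :=
  exists (phi0 : tc_V X -> 'cV[R]_d) (c : R) (A : 'M[R]_d) (b : 'cV[R]_d),
    [/\ normalized_standard phi0, 0 < c, orthogonal_mx A
      & forall x, phi x = c *: (A *m phi0 x) + b].

End Crystals.

(** * Groups of congruence transformations *)

Section Congruences.
Variables (R : realType) (d : nat).

(* (A, b) stands for the map x |-> A x + b. *)
Notation congr := ('M[R]_d * 'cV[R]_d)%type.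

Definition capply (g : congr) (x : 'cV[R]_d) : 'cV[R]_d := g.1 *m x + g.2.

Definition congruence_group (Gamma : set congr) :=
  [/\ forall g, Gamma g -> orthogonal_mx g.1,
      Gamma (1%:M, 0),
      forall g h, Gamma g -> Gamma h -> Gamma (g.1 *m h.1, g.1 *m h.2 + g.2)
    & forall g, Gamma g -> Gamma (g.1^T, - (g.1^T *m g.2))].

(* Discreteness is that of Gamma as a subset of the isometry group, and
   co-compactness is stated through a compact set meeting all orbits. *)
Definition crystallographic_group (Gamma : set congr) :=
  [/\ congruence_group Gamma,
      Gamma `<=` isolated Gamma
    & exists D : set 'cV[R]_d, compact D /\
        forall x, exists2 g, Gamma g & D (capply g x)].

Definition preserves (Gamma : set congr) (S : set 'cV[R]_d) :=
  forall g, Gamma g -> capply g @` S = S.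

Definition contains_translations (Gamma : set congr) (S : set 'cV[R]_d) :=
  forall u, S u -> Gamma (1%:M, u).

Definition point_group (Gamma : set congr) : set 'M[R]_d := fst @` Gamma.

(* The isotropy group of p, as a subgroup of the point group. *)
Definition isotropy (Gamma : set congr) (p : 'cV[R]_d) : set 'M[R]_d :=
  fst @` [set g | Gamma g /\ capply g p = p].

Definition fixed_vectors (K : set 'M[R]_d) : set 'cV[R]_d :=
  [set u | forall A, K A -> A *m u = u].

Definition irreducible_action (K : set 'M[R]_d) : Prop :=
  (0 < d)%N /\
  forall W : {vspace 'cV[R]_d},
    (forall A u, K A -> u \in W -> A *m u \in W) -> W = 0%VS \/ W = fullv.

End Congruences.

(* Main.v *)
Require Import Defs.
From HB Require Import structures.
From mathcomp Require Import all_boot all_order all_algebra.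
From mathcomp Require Import complex.
From mathcomp Require Import all_classical all_reals all_analysis.
From mathcomp Require Import ring lra zify.
Set Implicit Arguments.
Unset Strict Implicit.
Unset Printing Implicit Defensive.
Import Order.TTheory GRing.Theory Num.Theory.
Import numFieldNormedType.Exports.
Local Open Scope classical_set_scope.
Local Open Scope ring_scope.

Local Notation inv := Defs.inv.

(** The group Gamma preserves the image of [Phi], and vertices can be recognized
    in this image as the points from which segments issue in at least three
    directions.  Hence Gamma maps vertices to vertices and edges to edges
    ([Gamma_vertex], [Gamma_edge]).  Vertices are isolated from each other and
    span the space affinely, so an isometry of Gamma close to another one agrees
    with it ([Gamma_discrete]).

    Let v be the building cochain, a function on the edges of the base graph.
    The isotropy group at a vertex x permutes the edges issuing from x, so it
    fixes the sum of the v(e) over these edges; by hypothesis (2) this sum is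
    zero, which means that the coordinates of v are cycles
    ([isotropy_harmonic]).  The symmetric operator S, sum of v(e) v(e)^T over
    the edges of the base graph, commutes with the point group
    ([frame_operator_invariant]), so by irreducibility S is a positive scalar
    ([tight_frame]): the coordinates of v are orthogonal cycles of the same
    norm.  The invariance of S needs an argument, because the elements of Gamma
    need not normalize the period lattice and so do not act on the base graph;
    they do act on its quotient by all translations of Gamma, whose fibres all
    have the same number of edges.

    It remains to see that the coordinates of v form a basis of the orthogonal
    complement of the vanishing subgroup in the space of cycles.  They belong to
    it since v integrates to zero along the closed walks of the crystal.
    Conversely, a cycle f in this complement integrates to a function F on the
    crystal which grows linearly along the period lattice, like l(Phi) for some
    linear form l.  Then F - l(Phi) comes from the base graph, so f - l(v) is
    both a cycle and a coboundary, hence zero ([vanishing_orth_coord]).  In the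
    orthonormal basis obtained by normalizing the coordinates of v, the
    normalized standard realization is a multiple of [Phi]. *)

(** * Linear algebra *)

(** The real or the imaginary part of a complex eigenvector will do, once the
    eigenvalue is known to be real. *)
Lemma symmetric_eigenvector (R : rcfType) n (S : 'M[R]_n) :
  (0 < n)%N -> S^T = S ->
  exists (a : R) (u : 'cV[R]_n), u != 0 /\ S *m u = a *: u.
Proof.
move=> n0 symS.
pose iC := real_complex R.
have [z /eigenvalueP [w wS w0]] := eigenvalue_closed (map_mx iC S) n0.
pose x := map_mx (@complex.Re R) w; pose y := map_mx (@complex.Im R) w.
pose a := complex.Re z; pose b := complex.Im z.
have Re_sum (F : 'I_n -> complex R) :
    complex.Re (\sum_i F i) = \sum_i complex.Re (F i).
  by apply: (big_morph (@complex.Re R)) => // [[? ?] [? ?]].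
have Im_sum (F : 'I_n -> complex R) :
    complex.Im (\sum_i F i) = \sum_i complex.Im (F i).
  by apply: (big_morph (@complex.Im R)) => // [[? ?] [? ?]].
have xS : x *m S = a *: x - b *: y.
  apply/rowP => j; have := congr1 (fun v : 'rV_n => complex.Re (v 0 j)) wS.
  rewrite !mxE Re_sum => E; transitivity (complex.Re (z * w 0 j)).
    rewrite -E; apply: eq_bigr => i _; rewrite !mxE.
    by case: (w 0 i) => r s /=; rewrite mulr0 subr0.
  by rewrite /a /b; case: (z) => ? ?; case: (w 0 j).
have yS : y *m S = a *: y + b *: x.
  apply/rowP => j; have := congr1 (fun v : 'rV_n => complex.Im (v 0 j)) wS.
  rewrite !mxE Im_sum => E; transitivity (complex.Im (z * w 0 j)).
    rewrite -E; apply: eq_bigr => i _; rewrite !mxE.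
    by case: (w 0 i) => r s /=; rewrite mulr0 add0r.
  by rewrite /a /b; case: (z) => ? ?; case: (w 0 j).
have sq (v : 'rV[R]_n) : (v *m v^T) 0 0 = \sum_i v 0 i ^+ 2.
  by rewrite !mxE; apply: eq_bigr => i _; rewrite !mxE expr2.
have sq_ge0 (v : 'rV[R]_n) : 0 <= (v *m v^T) 0 0.
  by rewrite sq sumr_ge0 // => i _; rewrite sqr_ge0.
have sq_eq0 (v : 'rV[R]_n) : (v *m v^T) 0 0 = 0 -> v = 0.
  move=> /eqP; rewrite sq psumr_eq0; last by move=> i _; rewrite sqr_ge0.
  move=> /allP v0; apply/rowP => i; have := v0 i; rewrite mem_index_enum mxE.
  by rewrite /= sqrf_eq0 => /(_ isT) /eqP.
have xy0 : ~ (x = 0 /\ y = 0).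
  case=> x0 y0; move/eqP: w0; apply; apply/rowP => j.
  have := congr1 (fun v : 'rV_n => v 0 j) x0.
  have := congr1 (fun v : 'rV_n => v 0 j) y0.
  by rewrite !mxE; case: (w 0 j) => r s /= -> ->.
(* Symmetry of S makes the Hermitian norm of the eigenvector kill Im z. *)
have b0 : b = 0.
  have : (x *m S *m y^T) 0 0 = (y *m S *m x^T) 0 0.
    by rewrite -[LHS](mxE trmx_key (fun i j => (x *m S *m y^T) j i))
       -/(trmx _) !trmx_mul trmxK symS mulmxA.
  rewrite xS yS mulmxBl mulmxDl -!scalemxAl.
  have -> : y *m x^T = x *m y^T.
    by apply/matrixP => i j; rewrite !ord1 !mxE; apply: eq_bigr => k _;
       rewrite !mxE mulrC.
  have := sq_ge0 x; have := sq_ge0 y; have := sq_eq0 x; have := sq_eq0 y.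
  move: (x *m y^T) (x *m x^T) (y *m y^T) => r p q y_0 x_0 q_0 p_0.
  rewrite !mxE; move: (p 0 0) (q 0 0) (r 0 0) y_0 x_0 q_0 p_0
    => {p q r} p q r y_0 x_0 q_0 p_0 E.
  have /eqP : b * (p + q) = 0 by lra.
  rewrite mulf_eq0 => /orP [/eqP // | /eqP pq0].
  by case: xy0; split; [apply: x_0 | apply: y_0]; lra.
rewrite b0 scale0r subr0 in xS; rewrite b0 scale0r addr0 in yS.
have eig (v : 'rV[R]_n) : v *m S = a *: v -> S *m v^T = a *: v^T.
  by move=> vS; rewrite -[LHS]trmxK trmx_mul trmxK symS vS linearZ.
have [x0 | x0] := eqVneq x 0; last first.
  by exists a, x^T; rewrite eig // trmx_eq0.
exists a, y^T; rewrite eig // trmx_eq0; split => //.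
by apply/eqP => y0; apply: xy0.
Qed.

(** Schur's lemma; a symmetric matrix has a real eigenvalue, so the commutant
    causes no trouble over the reals. *)
Lemma irreducible_symmetric_scalar (R : realType) (d : nat)
    (K : set 'M[R]_d) (S : 'M[R]_d) :
  irreducible_action K -> S^T = S -> (forall A, K A -> A *m S = S *m A) ->
  exists a, S = a%:M.
Proof.
move=> [d0 irr] symS comS; have [a [u [u0 Su]]] := symmetric_eigenvector d0 symS.
pose W := lker (linfun (mulmx (S - a%:M) : 'cV[R]_d -> 'cV[R]_d)).
have memW w : (w \in W) = (S *m w == a *: w).
  by rewrite memv_ker lfunE /= mulmxBl mul_scalar_mx subr_eq0.
have [] := irr W.
- move=> A w KA; rewrite !memW => /eqP Sw.
  by rewrite mulmxA -(comS _ KA) -mulmxA Sw -scalemxAr.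
- move=> W0; have : u \in W by rewrite memW Su.
  by rewrite W0 memv0 (negPf u0).
- move=> Wf; exists a; apply/matrixP => i j.
  have : (delta_mx j 0 : 'cV[R]_d) \in W by rewrite Wf memvf.
  rewrite memW => /eqP /(congr1 (fun v : 'cV_d => v i 0)).
  by rewrite -colE !mxE eqxx andbT mulr_natr.
Qed.

Section Dotc.
Variables (R : realType) (E0 : finType).
Notation C := {ffun E0 -> R^o}.
Implicit Types f g h : C.

Lemma dotcC f g : dotc f g = dotc g f.
Proof. by congr (_ * _); apply: eq_bigr => e _; rewrite mulrC. Qed.

Lemma dotcDl f g h : dotc (f + g) h = dotc f h + dotc g h.
Proof.
rewrite /dotc -mulrDr -big_split; congr (_ * _); apply: eq_bigr => e _.
by rewrite !ffunE mulrDl.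
Qed.

Lemma dotcZl a f h : dotc (a *: f) h = a * dotc f h.
Proof.
rewrite /dotc mulrCA; congr (_ * _); rewrite big_distrr; apply: eq_bigr => e _.
by rewrite !ffunE -mulrA.
Qed.

Lemma dotc0l h : dotc 0 h = 0.
Proof. by rewrite -[0](scale0r h) dotcZl mul0r. Qed.

Lemma dotcBl f g h : dotc (f - g) h = dotc f h - dotc g h.
Proof. by rewrite dotcDl -[- g]scaleN1r dotcZl mulN1r. Qed.

Lemma dotc_suml I (r : seq I) (P : pred I) (F : I -> C) h :
  dotc (\sum_(i <- r | P i) F i) h = \sum_(i <- r | P i) dotc (F i) h.
Proof.
apply: (big_morph (fun f => dotc f h)); first by move=> f g; exact: dotcDl.
exact: dotc0l.
Qed.

Lemma dotcZr a f h : dotc h (a *: f) = a * dotc h f.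
Proof. by rewrite dotcC dotcZl (dotcC h). Qed.

Lemma dotcBr f g h : dotc h (f - g) = dotc h f - dotc h g.
Proof. by rewrite dotcC dotcBl !(dotcC h). Qed.

Lemma dotc_sumr I (r : seq I) (P : pred I) (F : I -> C) h :
  dotc h (\sum_(i <- r | P i) F i) = \sum_(i <- r | P i) dotc h (F i).
Proof. by rewrite dotcC dotc_suml; apply: eq_bigr => i _; exact: dotcC. Qed.

Lemma dotc_eq0 f : dotc f f = 0 -> f = 0.
Proof.
move=> /eqP; rewrite /dotc mulf_eq0 invr_eq0 pnatr_eq0 /=.
rewrite psumr_eq0; last by move=> e _; rewrite -expr2 sqr_ge0.
move=> /allP f0; apply/ffunP => e; have := f0 e.
by rewrite mem_index_enum /= -expr2 sqrf_eq0 ffunE => /(_ isT) /eqP.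
Qed.

(** Gram-Schmidt, dually: imposing one more equation [dotc a w = 0] corrects
    the projection by a multiple of the projection of [a]. *)
Lemma projection_on_equations (s : seq C) f :
  exists w, (forall a, a \in s -> dotc a w = 0) /\
    forall h, (forall a, a \in s -> dotc a h = 0) -> dotc (f - w) h = 0.
Proof.
elim: s f => [|a s IH] f.
  by exists f; split => // h _; rewrite subrr dotc0l.
have [w [sw fw]] := IH f; have [b [sb ab]] := IH a.
have aE h : (forall c, c \in s -> dotc c h = 0) -> dotc a h = dotc b h.
  by move=> /ab /eqP; rewrite dotcBl subr_eq0 => /eqP.
have [b0 | b0] := eqVneq (dotc b b) 0.
  exists w; split => [c | h hh]; last first.
    by apply: fw => c cs; apply: hh; rewrite inE cs orbT.
  by rewrite inE => /orP [/eqP -> | /sw //]; rewrite aE // (dotc_eq0 b0) dotc0l.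
pose t := dotc b w / dotc b b.
have sw' c : c \in s -> dotc c (w - t *: b) = 0.
  by move=> cs; rewrite dotcBr dotcZr sw // sb // mulr0 subr0.
exists (w - t *: b); split => [c | h hh].
  rewrite inE => /orP [/eqP -> | /sw' //].
  by rewrite aE // dotcBr dotcZr divfK // subrr.
have sh c : c \in s -> dotc c h = 0 by move=> cs; apply: hh; rewrite inE cs orbT.
have -> : f - (w - t *: b) = f - w + t *: b by rewrite opprB addrA addrAC.
by rewrite dotcDl dotcZl fw // -aE // hh ?inE ?eqxx // mulr0 addr0.
Qed.

(** [orth_proj] is defined by choice: what has to be supplied is the existence
    of a projection [w]. *)
Lemma orth_projP (W : set C) f w :
  W w -> (forall h, W h -> dotc (f - w) h = 0) ->
  W (orth_proj W f) /\ forall h, W h -> dotc (orth_proj W f) h = dotc f h.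
Proof.
move=> Ww fw; have [] : [set w | W w /\ forall h, W h -> dotc (f - w) h = 0]
    (orth_proj W f).
  by rewrite /orth_proj; case: xgetP => [x -> // | /(_ w)]; case.
move=> Wp fp; split=> // h /fp /eqP; rewrite dotcBl subr_eq0 => /eqP ->.
by [].
Qed.

End Dotc.

(** * Cycles of a finite graph *)

Lemma edge_inv_inj (V E : Type) (G : graph V E) : injective (inv G).
Proof. exact: can_inj (@inv_invol _ _ G). Qed.

Lemma ter_inv (V E : Type) (G : graph V E) e : ter G (inv G e) = org G e.
Proof. by rewrite -org_inv inv_invol. Qed.

Section Homology.
Variables (R : realType) (V0 E0 : finType) (G : graph V0 E0).
Notation C := {ffun E0 -> R^o}.

Lemma dotc_edge_chain (f : C) e : chains G f -> dotc f (edge_chain G R e) = f e.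
Proof.
move=> oddf; rewrite /dotc.
have -> : \sum_e' f e' * (edge_chain G R e) e' = f e - f (inv G e).
  under eq_bigr => e' _ do rewrite ffunE mulrBr.
  rewrite sumrB (bigD1 e) //= eqxx mulr1 big1 ?addr0; last first.
    by move=> i /negPf ->; rewrite mulr0.
  rewrite (bigD1 (inv G e)) //= eqxx mulr1 big1 ?addr0 //.
  by move=> i /negPf ->; rewrite mulr0.
by rewrite oddf opprK -mulr2n -[f e *+ 2]mulr_natl mulKf // pnatr_eq0.
Qed.

Lemma boundary_oddE (f : C) x : chains G f ->
  boundary G f x = - \sum_(e | org G e == x) f e.
Proof.
move=> oddf; rewrite ffunE; under eq_bigr => e _ do rewrite mulrBr.
rewrite sumrB.
have -> : \sum_e f e * (ter G e == x)%:R = - \sum_e f e * (org G e == x)%:R.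
  rewrite (reindex_inj (@edge_inv_inj _ _ G)) /= -sumrN; apply: eq_bigr => e _.
  by rewrite oddf ter_inv mulNr.
rewrite [in RHS]big_mkcond /= -opprD mulrN -mulr2n -[X in _ * X]mulr_natl.
rewrite mulKf ?pnatr_eq0 //.
by congr (- _); apply: eq_bigr => e _; case: eqP; rewrite ?mulr1 ?mulr0.
Qed.

(** This puts the space of cycles in the form required by
    [projection_on_equations], through the equations
    [f e + f (inv e) = 0] and [boundary f x = 0]. *)
Lemma homology1_equations : exists s : seq C, forall f,
  homology1 G f <-> (forall a, a \in s -> dotc a f = 0).
Proof.
pose odd_eq e : C := [ffun e' => (e' == e)%:R + (e' == inv G e)%:R].
pose bd_eq x : C := [ffun e => (ter G e == x)%:R - (org G e == x)%:R].
have oddE e f : dotc (odd_eq e) f = 2^-1 * (f e + f (inv G e)).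
  congr (_ * _); under eq_bigr => e' _ do rewrite ffunE mulrDl.
  rewrite big_split /= (bigD1 e) //= eqxx mul1r big1 ?addr0; last first.
    by move=> i /negPf ->; rewrite mul0r.
  rewrite (bigD1 (inv G e)) //= eqxx mul1r big1 ?addr0 //.
  by move=> i /negPf ->; rewrite mul0r.
have bdE x f : dotc (bd_eq x) f = boundary G f x.
  by rewrite ffunE; congr (_ * _); apply: eq_bigr => e _; rewrite ffunE mulrC.
exists ([seq odd_eq e | e : E0] ++ [seq bd_eq x | x : V0]) => f; split.
  case=> oddf bf a; rewrite mem_cat => /orP [] /codomP [y ->].
    by rewrite oddE oddf subrr mulr0.
  by rewrite bdE bf ffunE.
move=> H; split.
  move=> e; have /eqP : dotc (odd_eq e) f = 0.
    by apply: H; rewrite mem_cat codom_f.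
  by rewrite oddE mulf_eq0 invr_eq0 pnatr_eq0 /= addrC addr_eq0 => /eqP.
apply/ffunP => x; rewrite -bdE H ?ffunE //.
by rewrite mem_cat codom_f orbT.
Qed.

(** The projection exists by [projection_on_equations]; it may be removed from
    an inner product with a cycle, and [edge_chain] evaluates odd functions. *)
Lemma v0P e : homology1 G (v0 G R e) /\
  forall h, homology1 G h -> dotc (v0 G R e) h = h e.
Proof.
have [s sP] := homology1_equations.
have [w [ws ew]] := projection_on_equations s (edge_chain G R e).
have [|h /sP hs|Hv vE] := orth_projP (W := homology1 G (R := R))
  (f := edge_chain G R e) (w := w).
- exact/sP.
- exact: ew.
by split=> // h Hh; rewrite vE // dotcC dotc_edge_chain //; case: Hh.
Qed.

(** Summation by parts turns the left-hand side into the pairing of [h] with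
    the boundary of [g]. *)
Lemma dotc_coboundary (h : V0 -> R) (f g : C) :
  (forall e, f e = h (ter G e) - h (org G e)) -> homology1 G g ->
  dotc f g = 0.
Proof.
move=> fE [_ bg]; transitivity (\sum_x h x * boundary G g x); last first.
  by rewrite bg big1 // => x _; rewrite ffunE mulr0.
under eq_bigr => x _ do rewrite ffunE mulrCA big_distrr.
rewrite /dotc -big_distrr exchange_big; congr (_ * _); apply: eq_bigr => e _ /=.
rewrite fE mulrC (eq_bigr (fun x => g e * (h x * (ter G e == x)%:R) -
   g e * (h x * (org G e == x)%:R))); last by move=> x _; ring.
rewrite sumrB -!big_distrr /= mulrBr.
have D y : \sum_x h x * (y == x)%:R = h y.
  rewrite (bigD1 y) //= eqxx mulr1 big1 ?addr0 // => x.
  by rewrite eq_sym => /negPf ->; rewrite mulr0.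
by rewrite !D.
Qed.

End Homology.
(** * Continuity of matrix operations *)

Lemma matrix_continuous (R : realType) (T : topologicalType) m n
    (f : T -> 'M[R]_(m, n)) :
  (forall i j, continuous (fun x => f x i j)) -> continuous f.
Proof.
move=> fc x; apply/cvg_ballP => eps eps0.
have : \forall y \near x, forall i j, ball (f x i j) eps (f y i j).
  apply: filter_forall => i; apply: filter_forall => j.
  exact: (iffLR (cvg_ballP (fun y => f y i j) (f x i j)) (fc i j x)).
by apply: filterS => y xy; split.
Qed.

Lemma mulmx_continuous (R : realType) (T : topologicalType) m n p
    (f : T -> 'M[R]_(m, n)) (g : T -> 'M[R]_(n, p)) :
  continuous f -> continuous g -> continuous (fun x => f x *m g x).
Proof.
move=> fc gc; apply: matrix_continuous => i k.
under eq_fun do rewrite mxE.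
apply: continuous_big => [|j _ x]; first exact: add_continuous.
apply: cvgM.
  exact: cvg_comp (fc x) (@coord_continuous _ _ _ i j _).
exact: cvg_comp (gc x) (@coord_continuous _ _ _ j k _).
Qed.

Lemma coord_le_norm (R : realType) d (w : 'cV[R]_d) j : `|w j 0| <= `|w|.
Proof.
rewrite [leRHS]/Num.norm /= mx_normrE.
by rewrite (le_bigmax _ (fun ij => `|w ij.1 ij.2|) (j, 0)).
Qed.

(** * Coverings *)

Section Covering.
Variables (V0 E0 : finType) (X0 : graph V0 E0) (d : nat).
Variable X : topological_crystal X0 d.
Notation G := (tc_graph X).

Lemma edge_at_eq e e' :
  org G e = org G e' -> tc_pe e = tc_pe e' -> e = e'.
Proof.
move=> oe pe; have [f [_ fu]] := tc_p_local (tc_p_org e).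
by rewrite -(fu e) // -(fu e') // oe pe.
Qed.

Lemma lift_at x e0 : org X0 e0 = tc_pv x ->
  exists e, org G e = x /\ tc_pe e = e0.
Proof. by move=> /tc_p_local [e [] He _]; exists e. Qed.

Lemma lift_edge e0 : exists e : tc_E X, tc_pe e = e0.
Proof.
have [x /esym /lift_at [e [_ <-]]] := tc_p_surj X (org X0 e0).
by exists e.
Qed.

Lemma same_fibre_edge (e e' : tc_E X) : tc_pe e = tc_pe e' ->
  exists s, e' = tc_ae s e.
Proof.
move=> pe; have : tc_pv (org G e) = tc_pv (org G e') by rewrite -!tc_p_org pe.
move=> /tc_a_simply_transitive [s [sE _]]; exists s.
by apply: edge_at_eq; rewrite ?tc_a_org ?tc_a_pe.
Qed.

Lemma covering_degree k : degree_ge X0 k -> degree_ge G k.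
Proof.
move=> deg x; have [f [finj fx]] := deg (tc_pv x).
have /choice [e He] : forall i, exists e, org G e = x /\ tc_pe e = f i.
  by move=> i; apply: lift_at.
exists e; split=> [i j eij|i]; last by case: (He i).
by apply: finj; rewrite -(He i).2 -(He j).2 eij.
Qed.

Lemma walk_ind_connected (P : tc_V X -> Prop) x :
  (forall e, P (org G e) -> P (ter G e)) -> P x -> forall y, P y.
Proof.
move=> Pe Px y; have [_ /(_ x y) [p]] := tc_connected X.
elim: p x Px => [|e p IH] x Px /=; first by move=> <-.
by case=> ox; apply: IH; apply: Pe; rewrite ox.
Qed.

End Covering.

Lemma at_vertex_end (V E : Type) (G : graph V E) (R : realType) (p : E * R) x :
  at_vertex G p x -> p.2 = 0 \/ p.2 = 1.
Proof. by case=> [[-> _]|[-> _]]; [left|right]. Qed.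

Lemma at_vertex0 (V E : Type) (G : graph V E) (R : realType) e x :
  at_vertex G (e, 0 : R) x -> org G e = x.
Proof. by case=> [[_ //]|[/= /esym/eqP]]; rewrite oner_eq0. Qed.

Lemma infinite_pigeonhole (I : finType) (P : I -> nat -> Prop) :
  (forall n, exists i, P i n) ->
  exists i, forall N, exists2 n, (N <= n)%N & P i n.
Proof.
move=> Pn; apply: contrapT => /forallNP H.
have /choice [N HN] : forall i, exists N, forall n, (N <= n)%N -> ~ P i n.
  move=> i; have /existsNP [N] := H i.
  by move=> /forall2NP HN; exists N => n Nn; case: (HN n).
have [j] := Pn (\max_i N i).
by apply: HN; exact: leq_bigmax.
Qed.

(** * Injective periodic realizations *)

Section Realization.
Variables (R : realType) (V0 E0 : finType) (X0 : graph V0 E0).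
Variables (d : nat) (X : topological_crystal X0 d).
Variables (rho : {additive tc_L X -> 'cV[R]_d}) (Phi : tc_V X -> 'cV[R]_d).
Hypothesis X0_degree : degree_ge X0 3.
Hypothesis Phi_periodic : periodic_realization rho Phi.
Hypothesis Phi_injective : injective_realization Phi.
Notation G := (tc_graph X).
Notation v := (building_cochain Phi).
Notation Y := (realization_image Phi).

Lemma realizeE e s : realize Phi (e, s) = Phi (org G e) + s *: v e.
Proof.
rewrite /realize /building_cochain /= scalerBr scalerBl scale1r.
by rewrite addrAC -addrA.
Qed.

Lemma realize0 e : realize Phi (e, 0) = Phi (org G e).
Proof. by rewrite realizeE scale0r addr0. Qed.

Lemma realize1 e : realize Phi (e, 1) = Phi (ter G e).
Proof. by rewrite realizeE scale1r addrC subrK. Qed.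

Lemma building_inv e : v (inv G e) = - v e.
Proof. by rewrite /building_cochain ter_inv org_inv opprB. Qed.

Lemma building_translate s e : v (tc_ae s e) = v e.
Proof.
case: Phi_periodic => _ _ per.
by rewrite /building_cochain tc_a_ter tc_a_org !per opprD addrACA subrr addr0.
Qed.

Lemma building_fibre e e' : tc_pe e = tc_pe e' -> v e = v e'.
Proof. by move=> /same_fibre_edge [s ->]; rewrite building_translate. Qed.

Lemma outgoing_edge x : exists e, org G e = x.
Proof.
have deg : degree_ge G 3 by apply: covering_degree.
by have [f [_ fx]] := deg x; exists (f 0).
Qed.

(** Two interior points of a collapsed edge would have the same image. *)
Lemma building_neq0 e : v e != 0.
Proof.
apply/eqP => ve0.
have : realize Phi (e, 3^-1) = realize Phi (e, 2^-1).
  by rewrite !realizeE ve0 !scaler0.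
case/Phi_injective => {ve0}.
- by rewrite /on_edge /=; lra.
- by rewrite /on_edge /=; lra.
- by case; lra.
- by case=> /esym eE _; case: (inv_neq eE).
- by case=> x [H _]; case: (at_vertex_end H) => /= ?; lra.
Qed.

(** Injectivity is up to the identification of [e] with its reversal, whence
    the two cases. *)
Lemma interior_point e s e' s' :
  0 < s < 1 -> 0 <= s' <= 1 -> realize Phi (e, s) = realize Phi (e', s') ->
  (e' = e /\ s' = s) \/ (e' = inv G e /\ s' = 1 - s).
Proof.
move=> s01 s01' /Phi_injective [].
- by rewrite /on_edge /=; lra.
- by [].
- by case=> -> ->; left.
- by case=> -> ->; right.
- by case=> x [H _]; case: (at_vertex_end H) => /= ?; lra.
Qed.

Lemma interior_not_vertex e s x : 0 < s < 1 -> realize Phi (e, s) <> Phi x.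
Proof.
have [f <-] := outgoing_edge x; rewrite -realize0 => s01.
by case/(interior_point s01) => [||[]]; lra.
Qed.

Lemma vertex_inj x y : Phi x = Phi y -> x = y.
Proof.
have [e <-] := outgoing_edge x; have [f <-] := outgoing_edge y.
rewrite -!realize0 => /Phi_injective [].
- by rewrite /on_edge /=; lra.
- by rewrite /on_edge /=; lra.
- by case=> ->.
- by case=> _ /= H; exfalso; lra.
- by case=> z [He Hf]; rewrite (at_vertex0 He) (at_vertex0 Hf).
Qed.

(** The midpoints of two such edges coincide. *)
Lemma edge_inj e e' :
  Phi (org G e) = Phi (org G e') -> Phi (ter G e) = Phi (ter G e') -> e = e'.
Proof.
move=> o t; have vE : v e = v e' by rewrite /building_cochain o t.
have half : 0 < 2^-1 :> R /\ 2^-1 < 1 :> R by split; lra.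
have [|||[-> //]|[e'E _]] := @interior_point e 2^-1 e' 2^-1.
- by rewrite half.1 half.2.
- by rewrite !ltW ?half.1 ?half.2.
- by rewrite !realizeE o vE.
have /eqP := building_neq0 e; case.
by apply/eqP; rewrite /building_cochain subr_eq0 o e'E org_inv.
Qed.

(** The edges over a given edge of the base graph are indexed by the integral
    vectors, finitely many of which are bounded by a given constant. *)
Lemma bounded_edges (M : R) :
  exists (I : finType) (F : I -> tc_E X), forall e s, 0 <= s <= 1 ->
    (forall i, `|realize Phi (e, s) i 0| <= M) -> exists i, F i = e.
Proof.
case: Phi_periodic => rho_inj [B [Bunit rhoB]] per.
have [l lP] := choice (@lift_edge _ _ _ _ X).
pose Q := \sum_e0 \sum_i (`|Phi (org G (l e0)) i 0| + `|v (l e0) i 0|).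
have QP e0 i : `|Phi (org G (l e0)) i 0| + `|v (l e0) i 0| <= Q.
  have ge0 e j : 0 <= `|Phi (org G (l e)) j 0| + `|v (l e) j 0|.
    by rewrite addr_ge0.
  rewrite /Q (bigD1 e0) //= (bigD1 i) //= -addrA lerDl addr_ge0 ?sumr_ge0 //.
  by move=> e _; apply: sumr_ge0.
pose k := \sum_i \sum_j `|invmx B i j| * (M + Q).
pose N := Num.bound k.
have [sh shP] : exists sh : ('I_d -> int) -> tc_L X, forall n,
    rho (sh n) = B *m map_mx intr (\col_i n i).
  have : forall n : 'I_d -> int, exists s,
      rho s = B *m map_mx intr (\col_i n i) :> 'cV[R]_d.
    move=> n; have : range rho (B *m map_mx intr (\col_i n i)).
      by rewrite rhoB; exists (\col_i n i).
    by case=> s _ sE; exists s.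
  by move=> /choice [sh shP]; exists sh.
pose I := (E0 * {ffun 'I_d -> 'I_(2 * N).+1})%type.
exists I; exists (fun p : I => tc_ae (sh (fun i => (p.2 i)%:Z - N%:Z)) (l p.1)).
move=> e s s01 eM; have [t eE] := same_fibre_edge (lP (tc_pe e)).
have : range rho (rho t) by exists t.
rewrite rhoB => -[n _ nE].
have rho_t j : `|rho t j 0| <= M + Q.
  have -> : rho t = realize Phi (e, s) -
      (Phi (org G (l (tc_pe e))) + s *: v (l (tc_pe e))).
    rewrite realizeE [in v e]eE building_translate opprD addrACA subrr addr0.
    by rewrite [in Phi (org G e)]eE tc_a_org per addrAC subrr add0r.
  rewrite mxE [X in _ + X]mxE; apply: le_trans (ler_normD _ _) _.
  rewrite lerD ?eM // normrN; apply: le_trans (QP (tc_pe e) j).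
  rewrite mxE; apply: le_trans (ler_normD _ _) _; rewrite lerD2l.
  rewrite mxE normrM ler_piMl // ger0_norm; by case/andP: s01.
have nk i : `|(n i 0)%:~R : R| <= k.
  have -> : (n i 0)%:~R = \sum_j invmx B i j * rho t j 0 :> R.
    transitivity ((invmx B *m rho t) i 0); last by rewrite mxE.
    by rewrite -nE mulKmx // mxE.
  have le_term j : `|invmx B i j * rho t j 0| <= `|invmx B i j| * (M + Q).
    by rewrite normrM ler_wpM2l.
  apply: le_trans (ler_norm_sum _ _ _) _.
  apply: le_trans (ler_sum _ (fun j _ => le_term j)) _.
  rewrite /k [leRHS](bigD1 i) //= lerDl; apply: sumr_ge0 => i' _.
  apply: sumr_ge0 => j _; rewrite mulr_ge0 //.
  exact: le_trans (rho_t j).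
have nN i : `|n i 0| < N%:Z.
  rewrite -(ltr_int R) intr_norm; apply: le_lt_trans (nk i) _.
  by apply: archi_boundP; apply: le_trans (nk i).
pose m : {ffun 'I_d -> 'I_(2 * N).+1} := [ffun i => inord (absz (n i 0 + N%:Z))].
have mE i : (m i)%:Z - N%:Z = n i 0.
  have ge0 : 0 <= n i 0 + N%:Z by have := nN i; lia.
  rewrite ffunE inordK; last by have := nN i; lia.
  by rewrite gez0_abs // addrK.
exists (tc_pe e, m) => /=; rewrite [RHS]eE; congr tc_ae; apply: rho_inj.
rewrite shP -nE; congr (_ *m _); apply/matrixP => i j.
by rewrite !mxE mE ord1.
Qed.

(** * The image near a point *)

(** Among the points [y + u / n], infinitely many lie on the same edge [e],
    because finitely many edges meet the segment.  Two of them already show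
    that [u] is parallel to [e], and [y] lies on [e] because [e] is closed. *)
Lemma segment_in_edge y u :
  u != 0 -> (forall r, 0 <= r <= 1 -> Y (y + r *: u)) ->
  exists e s c, [/\ y = realize Phi (e, s), u = c *: v e,
    0 <= s <= 1 & exists2 r, 0 < r & 0 <= s + c * r <= 1].
Proof.
move=> u0 Yu; pose r n : R := n.+1%:R^-1.
have r_gt0 n : 0 < r n by rewrite invr_gt0 ltr0Sn.
have r_le1 n : r n <= 1 by rewrite invf_le1 ?ltr0Sn // ler1n.
have [I [F FP]] := bounded_edges (`|y| + `|u|).
have [i iP] : exists i, forall N, exists2 n, (N <= n)%N &
    exists2 s, 0 <= s <= 1 & y + r n *: u = realize Phi (F i, s).
  apply: infinite_pigeonhole => n.
  have [|[e s] s01 /= esE] := Yu (r n); first by rewrite ltW ?r_gt0 ?r_le1.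
  have [j|i iE] := FP e s s01; last by exists i; exists s => //; rewrite iE esE.
  rewrite esE mxE [X in _ + X]mxE; apply: le_trans (ler_normD _ _) _.
  rewrite lerD ?coord_le_norm // normrM; apply: le_trans (coord_le_norm u j).
  by rewrite ler_piMl // ger0_norm // ltW.
set e := F i in iP; have ve0 := building_neq0 e.
have [n1 _ [s1 s1_01 E1]] := iP 0%N; have [n2 n12 [s2 s2_01 E2]] := iP n1.+1.
have r12 : r n1 - r n2 != 0.
  rewrite subr_eq0 (inj_eq invr_inj) eqr_nat eqSS; apply/eqP => nE.
  by rewrite nE ltnn in n12.
pose c := (s1 - s2) / (r n1 - r n2).
have uE : u = c *: v e.
  apply: (scalerI r12); rewrite scalerA [_ * c]mulrC divfK //.
  rewrite !realizeE in E1 E2; rewrite !scalerBl.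
  have -> : s1 *: v e = y + r n1 *: u - Phi (org G e) by rewrite E1 addrC addKr.
  have -> : s2 *: v e = y + r n2 *: u - Phi (org G e) by rewrite E2 addrC addKr.
  by rewrite opprB [RHS]addrA subrK opprD addrACA subrr add0r.
pose s := s1 - c * r n1.
have yE : y = realize Phi (e, s).
  rewrite realizeE /s scalerBl mulrC -scalerA -uE addrA -realizeE -E1.
  by rewrite addrK.
have s_n n t : y + r n *: u = realize Phi (e, t) -> t = s + c * r n.
  rewrite yE uE !realizeE scalerA -addrA -scalerDl mulrC.
  by move/addrI/eqP; rewrite -subr_eq0 -scalerBl scaler_eq0 (negPf ve0) orbF
    subr_eq0 => /eqP.
exists e, s, c; split=> //; last first.
  by exists (r n1) => //; rewrite -(s_n _ _ E1).
have small eps : 0 < eps -> exists n, `|c * r n| < eps /\ 0 <= s + c * r n <= 1.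
  move=> eps0; have [n Nn [t t01 tE]] := iP (Num.bound (`|c| / eps)).
  exists n; split; last by rewrite -(s_n _ _ tE).
  rewrite normrM [X in _ * X]ger0_norm ?ltW // ltr_pdivrMr ?ltr0Sn //.
  rewrite mulrC -ltr_pdivrMr //; apply: lt_le_trans (archi_boundP _) _.
    by rewrite divr_ge0 // ltW.
  by rewrite ler_nat leqW.
apply/andP; split; rewrite leNgt; apply/negP => bad.
  have [|n []] := small (- s); first by rewrite oppr_gt0.
  by rewrite ltr_norml => *; lra.
have [|n []] := small (s - 1); first by rewrite subr_gt0.
by rewrite ltr_norml => *; lra.
Qed.

(** Vertices are recognized from the image alone as the points from which
    segments issue in three distinct directions.  This makes no reference to
    the graph, so every isometry preserving the image preserves it. *)
Definition branch_point (y : 'cV[R]_d) := exists u : 'I_3 -> 'cV[R]_d,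
  (forall i, u i != 0 /\ forall r, 0 <= r <= 1 -> Y (y + r *: u i)) /\
  forall i j c, i != j -> 0 < c -> u i <> c *: u j.

Lemma vertex_branch_point x : branch_point (Phi x).
Proof.
have deg : degree_ge G 3 by apply: covering_degree.
have [e [e_inj ex]] := deg x; exists (fun i => v (e i)); split=> [i|i j c ij c0].
  split; first exact: building_neq0.
  by move=> r r01; exists (e i, r) => //; rewrite realizeE ex.
(* If two edges at x had the same direction, they would meet at the points
   of parameters t and t c, where t is chosen so that both are less than 1. *)
move=> vE; have t_gt0 : 0 < (2 * (1 + c))^-1 by rewrite invr_gt0; lra.
set t := _^-1 in t_gt0; have tE : t * (2 * (1 + c)) = 1.
  by rewrite mulVf //; apply/eqP; lra.
have t1 : t < 1 by nra.
have tc1 : t * c < 1 by nra.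
have tc0 : 0 < t * c by rewrite mulr_gt0.
have [|||[/e_inj ji _]|[eE tc]] := @interior_point (e i) t (e j) (t * c).
- by rewrite t_gt0.
- by rewrite !ltW.
- by rewrite !realizeE !ex vE scalerA.
- by rewrite ji eqxx in ij.
- have := building_neq0 (e i); rewrite /building_cochain -(org_inv G) -eE.
  by rewrite !ex subrr eqxx.
Qed.

(** At an interior point of an edge, the image only leaves along the edge, so
    in two directions. *)
Lemma branch_point_vertex y : branch_point y -> exists x, y = Phi x.
Proof.
move=> [u [Yu ndir]].
have [e [s [_ [yE _ s01 _]]]] := segment_in_edge (Yu 0).1 (Yu 0).2.
have [s0 | s0] := eqVneq s 0; first by exists (org G e); rewrite yE s0 realize0.
have [s1 | s1] := eqVneq s 1; first by exists (ter G e); rewrite yE s1 realize1.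
have s_in : 0 < s < 1 by rewrite !lt_neqAle eq_sym s0 s1.
have /choice [c cP] : forall i, exists c, u i = c *: v e /\ c != 0.
  move=> i; have [f [t [c [yE' uE t01 _]]]] := segment_in_edge (Yu i).1 (Yu i).2.
  have c0 : c != 0.
    by apply/eqP => c0; have := (Yu i).1; rewrite uE c0 scale0r eqxx.
  have E : realize Phi (e, s) = realize Phi (f, t) by rewrite -yE.
  have [[fE _]|[fE _]] := interior_point s_in t01 E.
  - by exists c; rewrite uE fE.
  - by exists (- c); rewrite uE fE building_inv scalerN scaleNr oppr_eq0.
(* Two of the three coefficients c i have the same sign. *)
exfalso; have same i j : i != j -> ~ (0 < c i / c j).
  move=> ij cij; apply: (ndir i j _ ij cij).
  by rewrite (cP i).1 (cP j).1 scalerA divfK // (cP j).2.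
have := same 0 1 isT; have := same 0 2 isT; have := same 1 2 isT.
have := (cP 0).2; have := (cP 1).2; have := (cP 2).2.
move: (c 0) (c 1) (c 2) => a b f f0 b0 a0.
rewrite !neq_lt in a0 b0 f0.
have pos p q : 0 < p -> 0 < q -> 0 < p / q :> R.
  by move=> *; rewrite divr_gt0.
have neg p q : p < 0 -> q < 0 -> 0 < p / q :> R.
  by move=> *; rewrite -mulrNN -invrN divr_gt0 ?oppr_gt0.
by case/orP: a0 => ?; case/orP: b0 => ?; case/orP: f0 => ? H1 H2 H3;
  do [exact: H1 (pos _ _ _ _) | exact: H1 (neg _ _ _ _)
    | exact: H2 (pos _ _ _ _) | exact: H2 (neg _ _ _ _)
    | exact: H3 (pos _ _ _ _) | exact: H3 (neg _ _ _ _)].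
Qed.

(** * The action on vertices and edges *)

Variable Gamma : set ('M[R]_d * 'cV[R]_d).
Hypothesis Gamma_group : congruence_group Gamma.
Hypothesis Gamma_preserves : preserves Gamma Y.

Definition cinv (g : 'M[R]_d * 'cV[R]_d) : 'M[R]_d * 'cV[R]_d :=
  (g.1^T, - (g.1^T *m g.2)).

Lemma Gamma_inv g : Gamma g -> Gamma (cinv g).
Proof. by case: Gamma_group => _ _ _; apply. Qed.

Lemma Gamma_orth g : Gamma g -> g.1^T *m g.1 = 1%:M.
Proof. by case: Gamma_group => H _ _ _ /H. Qed.

Lemma Gamma_orth' g : Gamma g -> g.1 *m g.1^T = 1%:M.
Proof. by move=> /Gamma_orth /mulmx1C. Qed.

Lemma capplyK g p : Gamma g -> capply (cinv g) (capply g p) = p.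
Proof.
move=> Gg; rewrite /capply /= mulmxDr mulmxA (Gamma_orth Gg) mul1mx.
by rewrite -addrA subrr addr0.
Qed.

Lemma capplyD (g : 'M[R]_d * 'cV[R]_d) p u :
  capply g (p + u) = capply g p + g.1 *m u.
Proof. by rewrite /capply mulmxDr addrAC. Qed.

Lemma image_capply g p : Gamma g -> Y p -> Y (capply g p).
Proof. by move=> Gg Yp; rewrite -(Gamma_preserves Gg); exists p. Qed.

Lemma Gamma_vertex g x : Gamma g -> exists x', capply g (Phi x) = Phi x'.
Proof.
move=> Gg; apply: branch_point_vertex.
have [u [Yu ndir]] := vertex_branch_point x.
have invA w : g.1^T *m (g.1 *m w) = w by rewrite mulmxA Gamma_orth // mul1mx.
exists (fun i => g.1 *m u i); split=> [i|i j c ij c0 uE].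
  split.
    have [ui0 _] := Yu i; apply: contra_neq ui0 => gu0.
    by rewrite -[u i]invA gu0 mulmx0.
  move=> r r01; rewrite scalemxAr -capplyD; apply: image_capply => //.
  by case: (Yu i) => _; apply.
by apply: (ndir i j c ij c0); rewrite -[u i]invA uE -scalemxAr invA.
Qed.

Lemma Gamma_not_vertex g e s x : Gamma g -> 0 < s < 1 ->
  capply g (realize Phi (e, s)) <> Phi x.
Proof.
move=> Gg s01 gE; have [x' x'E] := Gamma_vertex x (Gamma_inv Gg).
by apply: (interior_not_vertex (e := e) (x := x') s01); rewrite -x'E -gE capplyK.
Qed.

(** By [edge_inj] an edge is determined by the images of its end points, so this
    describes the action of [g] on edges without constructing it. *)
Definition carries (g : 'M[R]_d * 'cV[R]_d) (e e' : tc_E X) : Prop :=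
  capply g (Phi (org G e)) = Phi (org G e') /\
  capply g (Phi (ter G e)) = Phi (ter G e').

(** The image of an edge starts along some edge [f] by [segment_in_edge].  If
    one of the two ended before the other, a vertex would be mapped to or from
    an interior point of an edge. *)
Lemma Gamma_edge g e : Gamma g -> exists e', carries g e e'.
Proof.
move=> Gg; have [x xE] := Gamma_vertex (org G e) Gg.
have gE s : capply g (realize Phi (e, s)) = Phi x + s *: (g.1 *m v e).
  by rewrite realizeE capplyD xE -scalemxAr.
have gv0 : g.1 *m v e != 0.
  apply: contra_neq (building_neq0 e) => gv0.
  by rewrite -[v e]mul1mx -(Gamma_orth Gg) -mulmxA gv0 mulmx0.
have [|f [s [c [yE uE s01 [r r0 sr]]]]] := segment_in_edge gv0 (y := Phi x).
  by move=> t t01; rewrite -gE; apply: image_capply => //; exists (e, t).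
(* Reversing f if necessary, it starts at x. *)
have {f s c yE uE s01 r r0 sr} [f [c [fx uE c0]]] :
    exists f c, [/\ org G f = x, g.1 *m v e = c *: v f & 0 < c].
  have c0 : c != 0 by apply: contra_neq gv0 => c0; rewrite uE c0 scale0r.
  have [s0 | s0] := eqVneq s 0.
    exists f, c; split=> //; last first.
      rewrite lt_neqAle eq_sym c0 -(pmulr_lge0 _ r0).
      by case/andP: sr; rewrite s0 add0r.
    by apply: vertex_inj; rewrite yE s0 realize0.
  have [s1 | s1] := eqVneq s 1.
    exists (inv G f), (- c); split; last first.
    - rewrite oppr_gt0 lt_neqAle c0 -(pmulr_lle0 _ r0).
      by case/andP: sr => _; rewrite s1 gerDl.
    - by rewrite building_inv uE scalerN scaleNr opprK.
    by apply: vertex_inj; rewrite org_inv yE s1 realize1.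
  case: (interior_not_vertex (e := f) (s := s) (x := x)) => //.
  by rewrite !lt_neqAle eq_sym s0 s1.
have c1 : c = 1.
  have [c_lt1|c_gt1|//] := ltgtP c 1.
    have := Gamma_vertex (ter G e) Gg; rewrite -realize1 gE scale1r uE -fx.
    rewrite -realizeE => -[z zE].
    by case: (interior_not_vertex (e := f) (s := c) (x := z)); rewrite ?c0.
  have c_inv : 0 < c^-1 < 1 by rewrite invr_gt0 c0 invf_lt1.
  case: (Gamma_not_vertex (e := e) (x := ter G f) Gg c_inv).
  by rewrite gE uE scalerA mulVf ?gt_eqF // scale1r -fx addrC subrK.
exists f; split; first by rewrite fx.
by rewrite -!realize1 gE scale1r uE c1 realizeE fx.
Qed.

Lemma carries_building g e e' : carries g e e' -> v e' = g.1 *m v e.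
Proof.
move=> [oE tE]; rewrite /building_cochain -oE -tE /capply mulmxBr.
by rewrite opprD addrACA subrr addr0.
Qed.

Lemma carries_uniq g e e1 e2 : carries g e e1 -> carries g e e2 -> e1 = e2.
Proof.
by move=> [P1 Q1] [P2 Q2]; apply: edge_inj; rewrite -?P1 -?Q1.
Qed.

Lemma carries_inv g e e' : Gamma g -> carries g e e' -> carries (cinv g) e' e.
Proof. by move=> Gg [oE tE]; split; rewrite -?oE -?tE capplyK. Qed.

(** * Discreteness and cocompactness *)

Hypothesis Gamma_translations : contains_translations Gamma (range rho).

Lemma lattice_generators : exists (B : 'M[R]_d) (s : 'I_d -> tc_L X),
  [/\ B \in unitmx, forall j, rho (s j) = col j B
    & forall t, exists n : 'I_d -> int, t = \sum_j s j *~ n j].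
Proof.
case: Phi_periodic => rho_inj [B [Bunit rhoB]] _; exists B.
have /choice [s sP] : forall j, exists s, rho s = col j B.
  move=> j; have : range rho (col j B).
    rewrite rhoB; exists (delta_mx j 0) => //; rewrite colE; congr (_ *m _).
    by apply/matrixP => i k; rewrite !mxE; case: andP.
  by case=> s _ <-; exists s.
exists s; split=> // t; have : range rho (rho t) by exists t.
rewrite rhoB => -[n _ nE]; exists (fun j => n j 0); apply: rho_inj.
rewrite -nE raddf_sum; apply/matrixP => i k; rewrite ord1 mxE summxE.
apply: eq_bigr => j _; rewrite raddfMz sP -scaler_int !mxE mulrC.
by [].
Qed.

Lemma vertex_gap y : exists2 delta, 0 < delta &
  forall x, `|Phi x - Phi y| < delta -> x = y.
Proof.
have [I [F FP]] := bounded_edges (`|Phi y| + 1).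
pose D i := `|Phi (org G (F i)) - Phi y|.
exists (\big[Num.min/1]_(i | Phi (org G (F i)) != Phi y) D i).
  apply: lt_bigmin => // i; rewrite /D normr_gt0 subr_eq0 //.
move=> x /bigmin_gtP [x1 xD]; have [e ex] := outgoing_edge x.
have [|j|i iE] := FP e 0; first by rewrite lexx ler01.
  apply: le_trans (coord_le_norm _ _) _; rewrite realize0 ex.
  by rewrite -[Phi x](subrK (Phi y)) addrC (le_trans (ler_normD _ _)) // lerD2l ltW.
apply: vertex_inj; apply/eqP; apply: contraT => xy.
by have := xD i; rewrite /D iE ex ltxx => /(_ xy).
Qed.

Lemma capply_continuous p :
  continuous (fun g : 'M[R]_d * 'cV[R]_d => capply g p).
Proof.
move=> g; apply: cvgD; last exact: cvg_snd.
apply: mulmx_continuous; last by move=> ?; exact: cvg_cst.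
by move=> ?; exact: cvg_fst.
Qed.

(** An isometry of the group near [g] agrees with [g] at finitely many
    affinely spanning vertices, since images of vertices are vertices. *)
Lemma Gamma_discrete : Gamma `<=` isolated Gamma.
Proof.
move=> g Gg; split; first exact/mem_set.
have [[x0] _] := tc_connected X.
have [B [s [Bunit sB _]]] := lattice_generators.
case: Phi_periodic => _ _ per.
pose p (o : option 'I_d) := if o is Some j then tc_av (s j) x0 else x0.
have [y yP] := choice (fun o => Gamma_vertex (p o) Gg).
have /choice [delta dP] : forall o, exists delta, 0 < delta /\
    forall x, `|Phi x - Phi (y o)| < delta -> x = y o.
  by move=> o; have [delta] := vertex_gap (y o); exists delta.
exists [set h | forall o, `|capply h (Phi (p o)) - Phi (y o)| < delta o].
  have FF : Filter (nbhs g) by exact: nbhs_filter.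
  apply: (@filter_forall _ (option 'I_d)
    (fun o h => `|capply h (Phi (p o)) - Phi (y o)| < delta o) (nbhs g) FF) => o.
  rewrite -yP.
  have sym h : `|capply g (Phi (p o)) - capply h (Phi (p o))| < delta o ->
      `|capply h (Phi (p o)) - capply g (Phi (p o))| < delta o.
    by rewrite distrC.
  apply: (@filterS _ _ FF _ _ sym).
  exact: cvgr_dist_lt (@capply_continuous (Phi (p o)) g) _ (dP o).1.
apply/seteqP; split=> h /=; last first.
  by move=> ->; split=> // o; rewrite yP subrr normr0 (dP o).1.
move=> [hV Gh]; have hg o : capply h (Phi (p o)) = capply g (Phi (p o)).
  have [x xE] := Gamma_vertex (p o) Gh.
  by rewrite yP xE; congr Phi; apply: (dP o).2; rewrite -xE.
have col_eq j : h.1 *m col j B = g.1 *m col j B.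
  have := hg (Some j); rewrite /= per sB !capplyD -/(p None) hg.
  by move/addrI.
have h1 : h.1 = g.1.
  rewrite -[h.1](mulmxK Bunit) -[g.1](mulmxK Bunit); congr (_ *m _).
  apply/matrixP => i j; have := congr1 (fun w : 'cV_d => w i 0) (col_eq j).
  by rewrite colE !mulmxA -!colE ![col _ _ _ _]mxE.
have := hg None; rewrite /capply h1 => /addrI h2.
by rewrite [h]surjective_pairing h1 h2 -surjective_pairing.
Qed.

(** The translates of a closed unit cell of the period lattice cover the
    space. *)
Lemma Gamma_cocompact : exists D : set 'cV[R]_d, compact D /\
  forall x, exists2 g, Gamma g & D (capply g x).
Proof.
case: Phi_periodic => _ [B [Bunit rhoB]] _.
exists ((fun w : 'rV[R]_d => B *m w^T) @`
  [set w : 'rV[R]_d | forall i, `[0, 1]%classic (w ord0 i)]); split.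
  apply: continuous_compact; last first.
    by apply: (@rV_compact R d (fun=> `[0, 1]%classic)) => i; apply: segment_compact.
  apply: continuous_subspaceT.
  apply: (@mulmx_continuous _ _ _ _ _ (fun=> B) trmx).
    exact: cst_continuous.
  apply: matrix_continuous => i j.
  by under eq_fun do rewrite mxE; exact: coord_continuous.
move=> x; pose z := invmx B *m x.
pose n : 'cV[int]_d := \col_i - Num.floor (z i 0).
exists (1%:M, B *m map_mx intr n).
  by apply: Gamma_translations; rewrite rhoB; exists n.
exists (z + map_mx intr n)^T.
  move=> i /=; rewrite 2!mxE [map_mx _ _ _ _]mxE [n _ _]mxE in_itv /= mulrNz.
  by have /andP [] := floor_itv (z i 0); rewrite intrD /=; lra.
by rewrite /capply trmxK mulmxDr mulKVmx //= mul1mx.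
Qed.

Lemma Gamma_crystallographic : crystallographic_group Gamma.
Proof.
split; [exact: Gamma_group | exact: Gamma_discrete | exact: Gamma_cocompact].
Qed.

(** * Harmonicity and tightness *)

Definition edge_lift (e0 : E0) : tc_E X := sval (cid (lift_edge X e0)).

Lemma edge_liftK e0 : tc_pe (edge_lift e0) = e0.
Proof. exact: svalP (cid (lift_edge X e0)). Qed.

Definition base_cochain (e0 : E0) : 'cV[R]_d := v (edge_lift e0).
Notation vb := base_cochain.

Lemma base_cochainE e : vb (tc_pe e) = v e.
Proof. by apply: building_fibre; rewrite edge_liftK. Qed.

Lemma base_cochain_inv e0 : vb (inv X0 e0) = - vb e0.
Proof. by rewrite -[in LHS](edge_liftK e0) -tc_p_inv base_cochainE building_inv. Qed.

(** The isotropy group of a vertex permutes the edges issuing from it, so it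
    fixes the sum of their directions. *)
Lemma isotropy_harmonic x : fixed_vectors (isotropy Gamma (Phi x)) = [set 0] ->
  \sum_(e0 | org X0 e0 == tc_pv x) vb e0 = 0.
Proof.
move=> fix0; pose S : {set E0} := [set e0 | org X0 e0 == tc_pv x]%SET.
have inS e0 : (e0 \in S) = (org X0 e0 == tc_pv x) by rewrite inE.
under eq_bigl => e0 do rewrite -inS.
suff : fixed_vectors (isotropy Gamma (Phi x)) (\sum_(e0 in S) vb e0).
  by rewrite fix0.
move=> _ [g [Gg gx] <-].
have /choice [sg sgP] : forall e0, exists f0, e0 \in S -> exists e e',
    [/\ org G e = x, org G e' = x, tc_pe e = e0, tc_pe e' = f0 & carries g e e'].
  move=> e0; have [|_] := boolP (e0 \in S); last by exists e0.
  rewrite inS => /eqP Se0.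
  have [e [ex ee0]] := lift_at Se0; have [e' gee'] := Gamma_edge e Gg.
  exists (tc_pe e') => _; exists e, e'; split=> //; apply: vertex_inj.
  by rewrite -gee'.1 ex gx.
have sg_inj : {in S &, injective sg}.
  move=> e0 e1 /sgP [e [e' [ex ex' ee0 ee' ce]]] /sgP [f [f' [fx fx' fe1 ff' cf]]].
  move=> sgE; have e'f' : e' = f' by apply: edge_at_eq; rewrite ?ex' ?ee' ?sgE.
  rewrite -ee0 -fe1; congr tc_pe.
  apply: (@carries_uniq (cinv g) e'); first exact: carries_inv.
  by rewrite e'f'; exact: carries_inv.
have sgS : (sg @: S = S)%SET.
  apply/eqP; rewrite eqEcard card_in_imset // leqnn andbT.
  apply/fintype.subsetP => _ /imsetP [e0 /sgP [e [e' [_ ex' _ ee' _]]] ->].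
  by rewrite inS -ee' tc_p_org ex'.
rewrite mulmx_sumr; transitivity (\sum_(e0 in S) vb (sg e0)).
  apply: eq_bigr => e0 /sgP [e [e' [_ _ <- <- ce]]].
  by rewrite !base_cochainE (carries_building ce).
by rewrite -(big_imset (fun f0 => vb f0) sg_inj) sgS.
Qed.

(** The elements of Gamma need not normalize the period lattice, so on the edges
    of the base graph they induce correspondences rather than permutations. *)
Definition linear_part_rel (A : 'M[R]_d) (e0 f0 : E0) := exists e f h,
  [/\ Gamma h, h.1 = A, tc_pe e = e0, tc_pe f = f0 & carries h e f].

Lemma linear_part_rel_tr A e0 f0 :
  linear_part_rel A e0 f0 -> linear_part_rel A^T f0 e0.
Proof.
move=> [e [f [h [Gh <- <- <- ch]]]]; exists f, e, (cinv h).
by split=> //; [exact: Gamma_inv | exact: carries_inv].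
Qed.

Lemma linear_part_rel_lift A e f0 : linear_part_rel A (tc_pe e) f0 ->
  exists f h, [/\ Gamma h, h.1 = A, tc_pe f = f0 & carries h e f].
Proof.
move=> [e1 [f [h [Gh hA ee1 ff0 [oE tE]]]]].
have [s e1E] := same_fibre_edge (esym ee1).
case: Phi_periodic => _ _ per; case: Gamma_group => _ _ mulG _.
have Gs : Gamma (1%:M, rho s) by apply: Gamma_translations; exists s.
exists f, (h.1 *m 1%:M, h.1 *m rho s + h.2); split=> //.
- exact: (mulG h (1%:M, rho s)).
- by rewrite /= mulmx1.
- split; rewrite -?oE -?tE /capply /= mulmx1 e1E ?tc_a_org ?tc_a_ter per.
    by rewrite mulmxDr addrA.
  by rewrite mulmxDr addrA.
Qed.

Definition rel_row A e0 : {set E0} :=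
  finset (fun f0 => `[< linear_part_rel A e0 f0 >]).
Definition row_count A e0 := #|rel_row A e0|.

Lemma in_rel_row A e0 f0 : reflect (linear_part_rel A e0 f0) (f0 \in rel_row A e0).
Proof. by rewrite inE; exact: asboolP. Qed.

(** Two elements of Gamma with the same linear part differ by a translation
    [t] of Gamma, so all rows of all these correspondences count the
    translations of Gamma modulo the period lattice. *)
Lemma row_count_le A A' e0 e0' :
  point_group Gamma A -> point_group Gamma A' ->
  (row_count A e0 <= row_count A' e0')%N.
Proof.
move=> [g Gg gA] [g' Gg' gA']; case: Phi_periodic => _ _ per.
pose e := edge_lift e0; pose e' := edge_lift e0'.
have translate h : Gamma h -> h.1 = A -> Gamma (g'.1, g'.2 + (h.2 - g.2)).
  move=> Gh hA; case: Gamma_group => _ _ mulG _.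
  have := mulG _ _ (mulG _ _ Gh (Gamma_inv Gg)) Gg'.
  rewrite /= mulmxN mulmxA hA -gA (Gamma_orth' Gg) !mul1mx.
  by rewrite [- g.2 + _]addrC.
have /choice [phi phiP] : forall f0, exists f0', linear_part_rel A e0 f0 ->
    exists f f' h, [/\ Gamma h /\ h.1 = A, tc_pe f = f0, tc_pe f' = f0',
      carries h e f & carries (g'.1, g'.2 + (h.2 - g.2)) e' f'].
  move=> f0; have [|nrel] := pselect (linear_part_rel A e0 f0); last first.
    by exists f0.
  rewrite -{1}(edge_liftK e0) => /linear_part_rel_lift [f [h [Gh hA ff0 ch]]].
  have [f' cf'] := Gamma_edge e' (translate h Gh hA).
  by exists (tc_pe f') => _; exists f, f', h.
rewrite /row_count -(card_in_imset (f := phi)); last first.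
  move=> f0 f1 /in_rel_row rel0 /in_rel_row rel1 phiE.
  have [p0 [p0' [h0 [[G0 A0] pf0 pf0' c0 c0']]]] := phiP _ rel0.
  have [p1 [p1' [h1 [[G1 A1] pf1 pf1' c1 c1']]]] := phiP _ rel1.
  have [s p1'E] : exists s, p1' = tc_ae s p0'.
    by apply: same_fibre_edge; rewrite pf0' pf1'.
  have h1E : h1.2 = h0.2 + rho s.
    have := c1'.1; rewrite p1'E tc_a_org per -c0'.1 /capply /= -!addrA.
    by move=> /addrI /addrI; rewrite [- g.2 + _]addrC addrA => /addIr.
  have capE p : capply h1 p = capply h0 p + rho s.
    by rewrite /capply A0 A1 h1E addrA.
  rewrite -pf0 -pf1 -(tc_a_pe s p0); congr tc_pe; apply: edge_inj.
    by rewrite tc_a_org per -c0.1 -c1.1 capE.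
  by rewrite tc_a_ter per -c0.2 -c1.2 capE.
apply: subset_leq_card; apply/fintype.subsetP => _ /imsetP [f0 /in_rel_row rel0 ->].
have [f [f' [h [[Gh hA] _ <- _ cf']]]] := phiP _ rel0.
by apply/in_rel_row; exists e', f', (g'.1, g'.2 + (h.2 - g.2)); split=> //;
  [exact: translate | rewrite edge_liftK].
Qed.

Lemma row_count_gt0 A e0 : point_group Gamma A -> (0 < row_count A e0)%N.
Proof.
move=> [g Gg gA]; have [f cf] := Gamma_edge (edge_lift e0) Gg.
apply/card_gt0P; exists (tc_pe f); apply/in_rel_row.
by exists (edge_lift e0), f, g; rewrite edge_liftK.
Qed.

Lemma point_group_tr A : point_group Gamma A -> point_group Gamma A^T.
Proof. by move=> [g Gg <-]; exists (cinv g) => //; exact: Gamma_inv. Qed.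

Definition frame_operator := \sum_e0 vb e0 *m (vb e0)^T.

(** Double counting over the correspondence of [A], all of whose rows and
    columns have the same number of elements. *)
Lemma frame_operator_invariant A : point_group Gamma A ->
  A *m frame_operator *m A^T = frame_operator.
Proof.
move=> KA; have [x] : inhabited (tc_V X) by case: (tc_connected X).
have [e _] := outgoing_edge x; pose k := row_count A (tc_pe e).
have k_neq0 : k%:R != 0 :> R by rewrite pnatr_eq0 -lt0n row_count_gt0.
have row_k e0 : #|rel_row A e0| = k.
  by apply/eqP; rewrite eqn_leq !row_count_le.
have col_k f0 : #|[pred e0 | f0 \in rel_row A e0]| = k.
  transitivity (row_count A^T f0).
    apply: eq_card => e0; rewrite inE; apply/in_rel_row/in_rel_row.
      exact: linear_part_rel_tr.
    by move=> /linear_part_rel_tr; rewrite trmxK.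
  by apply/eqP; rewrite eqn_leq !row_count_le //; exact: point_group_tr.
pose T f0 := vb f0 *m (vb f0)^T.
apply: (scalerI k_neq0); rewrite !scaler_nat.
transitivity (\sum_e0 \sum_(f0 in rel_row A e0) T f0).
  rewrite mulmx_sumr mulmx_suml -sumrMnl; apply: eq_bigr => e0 _.
  rewrite -(row_k e0) -sumr_const; apply: eq_bigr => f0.
  move=> /in_rel_row [e1 [f [h [_ <- <- <- ch]]]].
  by rewrite /T !base_cochainE (carries_building ch) trmx_mul !mulmxA.
under eq_bigr => e0 _ do rewrite big_mkcond /=.
rewrite exchange_big -sumrMnl; apply: eq_bigr => f0 _.
rewrite -big_mkcond -(col_k f0) -sumr_const.
by apply: eq_bigl => e0; rewrite unfold_in.
Qed.

(** Schur's lemma applies to [frame_operator], which commutes with the point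
    group; the scalar is positive since no edge is collapsed. *)
Lemma tight_frame : irreducible_action (point_group Gamma) ->
  exists2 a : R, 0 < a &
    forall i j, \sum_e0 vb e0 i 0 * vb e0 j 0 = a *+ (i == j).
Proof.
move=> irr; have entry i j :
    \sum_e0 vb e0 i 0 * vb e0 j 0 = frame_operator i j.
  rewrite /frame_operator summxE; apply: eq_bigr => e0 _.
  by rewrite [RHS]mxE big_ord1 [(_^T) _ _]mxE.
have [||a aE] := irreducible_symmetric_scalar (S := frame_operator) irr.
- by apply/matrixP => i j; rewrite mxE -!entry; apply: eq_bigr => *; rewrite mulrC.
- move=> A KA; rewrite -[in RHS](frame_operator_invariant KA) -!mulmxA.
  by case: KA => g Gg <-; rewrite Gamma_orth // mulmx1.
exists a; last by move=> i j; rewrite entry aE mxE.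
have [x] : inhabited (tc_V X) by case: (tc_connected X).
have [e _] := outgoing_edge x.
have [i vi] : exists i, v e i 0 != 0.
  apply/existsP; apply: contraT; rewrite negb_exists => /forallP v0.
  have /eqP := building_neq0 e; case; apply/matrixP => i j.
  by rewrite ord1 [RHS]mxE; apply/eqP; have := v0 i; rewrite negbK.
have <- : frame_operator i i = a by rewrite aE mxE eqxx.
rewrite -entry (bigD1 (tc_pe e)) //= base_cochainE ltr_pwDl //.
  by rewrite -expr2 lt_neqAle eq_sym sqrf_eq0 vi sqr_ge0.
by apply: sumr_ge0 => f0 _; rewrite -expr2 sqr_ge0.
Qed.

(** * Standard realizations *)

Hypothesis harmonic : forall x0, \sum_(e0 | org X0 e0 == x0) vb e0 = 0.

Definition coord_cochain (i : 'I_d) : {ffun E0 -> R^o} :=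
  [ffun e0 => vb e0 i 0].
Notation vc := coord_cochain.

Lemma coord_cochain_homology1 i : homology1 X0 (vc i).
Proof.
have oddv : chains X0 (vc i).
  by move=> e0; rewrite !ffunE base_cochain_inv [LHS]mxE.
split=> //; apply/ffunP => x0; rewrite boundary_oddE // [RHS]ffunE.
have := congr1 (fun w : 'cV_d => w i 0) (harmonic x0).
rewrite /= summxE [RHS]mxE => E; apply/eqP; rewrite oppr_eq0; apply/eqP.
by rewrite -[RHS]E; apply: eq_bigr => e0 _; rewrite ffunE.
Qed.

Lemma walk_telescope (W : zmodType) (F : tc_V X -> W) x p y :
  walk G x p y -> \sum_(e <- p) (F (ter G e) - F (org G e)) = F y - F x.
Proof.
elim: p x => [|e p IH] x /=; first by move=> ->; rewrite big_nil subrr.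
by move=> [<- /IH E]; rewrite big_cons E addrC addrA subrK.
Qed.

Lemma walk_cat x p y q z : walk G x p y -> walk G y q z -> walk G x (p ++ q) z.
Proof.
elim: p x => [|e p IH] x /=; first by move=> ->.
by move=> [ox /IH pq] /pq.
Qed.

Lemma dotc_walk (f : {ffun E0 -> R^o}) (p : seq (tc_E X)) (a : {ffun E0 -> int^o}) :
  chains X0 f -> a = \sum_(e <- p) edge_chain X0 int (tc_pe e) ->
  dotc f [ffun e0 => (a e0)%:~R : R^o] = \sum_(e <- p) f (tc_pe e).
Proof.
move=> oddf ->.
have -> : [ffun e0 => ((\sum_(e <- p) edge_chain X0 int (tc_pe e)) e0)%:~R : R^o] =
    \sum_(e <- p) edge_chain X0 R (tc_pe e).
  apply/ffunP => e0; rewrite ffunE !sum_ffunE rmorph_sum; apply: eq_bigr => e _.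
  by rewrite !ffunE rmorphB /= !natz !pmulrn.
by rewrite dotc_sumr; apply: eq_bigr => e _; rewrite dotc_edge_chain.
Qed.

(** The integral along a closed walk of the crystal is the increment of a
    coordinate of [Phi], which is zero. *)
Lemma coord_cochain_orth i : vanishing_orth X (R := R) (vc i).
Proof.
split; first exact: coord_cochain_homology1.
move=> _ [n [c [h [hH ->]]]]; rewrite dotc_sumr big1 // => j _.
rewrite dotcZr; have [a [x [p [xp aE]]] <-] := hH j.
rewrite (dotc_walk _ aE); last by case: (coord_cochain_homology1 i).
rewrite tc_av0 in xp.
have := walk_telescope (fun y => Phi y i 0) xp; rewrite subrr => E.
rewrite (eq_bigr (fun e => Phi (ter G e) i 0 - Phi (org G e) i 0)).
  by rewrite E mulr0.
by move=> e _; rewrite ffunE base_cochainE /building_cochain mxE [X in _ + X]mxE.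
Qed.

(** The potential is the integral of [f] along a walk; this does not depend on
    the walk, since the class of a closed walk of the crystal is in the vanishing
    subgroup. *)
Lemma vanishing_orth_potential f : vanishing_orth X f ->
  exists F : tc_V X -> R, forall e, F (ter G e) - F (org G e) = f (tc_pe e).
Proof.
move=> [[oddf _] orthf]; have [[x0] conn] := tc_connected X.
have [P wP] := choice (conn x0).
have closed0 p : walk G x0 p x0 -> \sum_(e <- p) f (tc_pe e) = 0.
  move=> wp; pose a := \sum_(e <- p) edge_chain X0 int (tc_pe e).
  rewrite -(dotc_walk oddf (erefl a)); apply: orthf.
  exists 1%N, (fun=> 1), (fun=> [ffun e => (a e)%:~R : R^o]).
  split; last by rewrite big_ord1 scale1r.
  by move=> _; exists a => //; exists x0, p; rewrite tc_av0.
have indep p q y : walk G x0 p y -> walk G x0 q y ->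
    \sum_(e <- p) f (tc_pe e) = \sum_(e <- q) f (tc_pe e).
  move=> wp wq; have [r wr] := conn y x0.
  apply: (addIr (\sum_(e <- r) f (tc_pe e))).
  by rewrite -!big_cat !closed0 //; exact: walk_cat wr.
exists (fun y => \sum_(e <- P y) f (tc_pe e)) => e.
have we : walk G x0 (P (org G e) ++ [:: e]) (ter G e).
  by apply: walk_cat (wP _) _.
by rewrite (indep _ _ _ (wP (ter G e)) we) big_cat big_seq1 addrC addKr.
Qed.

(** The potential of a cycle orthogonal to the vanishing subgroup grows
    along the period lattice as a linear function of [Phi]; the difference is
    periodic, so it is a potential on the base graph, and a cycle which is
    also a coboundary is zero. *)
Lemma vanishing_orth_coord f : vanishing_orth X f ->
  exists c : 'I_d -> R, f = \sum_i c i *: vc i.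
Proof.
move=> Wf; have [F FP] := vanishing_orth_potential Wf.
have [[x0] _] := tc_connected X; case: Phi_periodic => _ _ per.
have [B [s [Bunit sB s_gen]]] := lattice_generators.
pose r t := F (tc_av t x0) - F x0.
have rE t x : F (tc_av t x) - F x = r t.
  move: x; apply: (walk_ind_connected (P := fun x => F (tc_av t x) - F x = r t)
    (x := x0)) => // e oE.
  have := FP (tc_ae t e); rewrite tc_a_pe tc_a_ter tc_a_org -FP -oE => E.
  by lra.
pose l : 'rV[R]_d := (\row_j r (s j)) *m invmx B.
pose L x := F x - (l *m Phi x) 0 0.
have ls j : (l *m rho (s j)) 0 0 = r (s j).
  by rewrite sB /l -mulmxA colE (mulmxA (invmx B)) mulVmx // mul1mx -colE !mxE.
have lD (u w : 'cV[R]_d) : (l *m (u + w)) 0 0 = (l *m u) 0 0 + (l *m w) 0 0.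
  by rewrite mulmxDr [LHS]mxE.
pose inv_by t := forall x, L (tc_av t x) = L x.
have inv_byP t : inv_by t <-> r t = (l *m rho t) 0 0.
  rewrite /inv_by /L; split=> [/(_ x0)|E x].
    by rewrite per lD /r; lra.
  by rewrite per lD -E -(rE t x); lra.
have inv0 : inv_by 0 by move=> x; rewrite tc_av0.
have invD t u : inv_by t -> inv_by u -> inv_by (t + u).
  by move=> It Iu x; rewrite tc_avD It Iu.
have invN t : inv_by t -> inv_by (- t).
  by move=> It x; rewrite -(It (tc_av (- t) x)) -tc_avD subrr tc_av0.
have invM t n : inv_by t -> inv_by (t *~ n).
  move=> It; have In k : inv_by (t *+ k).
    by elim: k => [|k IHk]; rewrite ?mulr0n // mulrS; exact: invD.
  by case: n => k; [exact: In | apply: invN; exact: In].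
have inv_all t : inv_by t.
  have [n ->] := s_gen t; apply: big_ind => // j _; apply: invM.
  by apply/inv_byP; rewrite ls.
have [h hE] : exists h : V0 -> R, forall x, L x = h (tc_pv x).
  have [lv lvE] := choice (@tc_p_surj _ _ _ _ X).
  exists (fun x => L (lv x)) => x.
  have [t [tx _]] := tc_a_simply_transitive (lvE (tc_pv x)).
  by rewrite -[in LHS]tx inv_all.
exists (l 0); pose q := f - \sum_i l 0 i *: vc i.
have qE e0 : q e0 = h (ter X0 e0) - h (org X0 e0).
  have [e <-] := lift_edge X e0.
  have lv : (l *m v e) 0 0 = (\sum_i l 0 i *: vc i) (tc_pe e).
    rewrite mxE sum_ffunE; apply: eq_bigr => i _.
    by rewrite !ffunE base_cochainE.
  rewrite tc_p_ter tc_p_org -!hE /L [LHS]ffunE [X in _ + X]ffunE -lv -FP.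
  have := lD (Phi (org G e)) (v e); rewrite [in LHS]addrC subrK; lra.
have Hq : homology1 X0 q.
  have [S SP] := homology1_equations R X0.
  apply/SP => a aS; rewrite dotcBr dotc_sumr.
  have -> : dotc a f = 0 by move: a aS; apply/SP; case: Wf.
  rewrite big1 ?subrr // => i _; rewrite dotcZr.
  have -> : dotc a (vc i) = 0; last by rewrite mulr0.
  by move: a aS; apply/SP; exact: coord_cochain_homology1.
by apply/eqP; rewrite -subr_eq0 -/q (dotc_eq0 (dotc_coboundary qE Hq)).
Qed.

(** Tightness makes the coordinate cochains, divided by [b], an orthonormal
    basis of [vanishing_orth].  In this basis the coordinates of the projection
    of [v0 e] are the values of the basis at [e], that is, those of the building
    cochain of [Phi] divided by [b]. *)
Lemma tight_harmonic_standard (a : R) : 0 < a ->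
  (forall i j, \sum_e0 vb e0 i 0 * vb e0 j 0 = a *+ (i == j)) ->
  standard_realization Phi.
Proof.
move=> a0 aP; pose b := Num.sqrt (a / 2).
have b0 : 0 < b by rewrite sqrtr_gt0 divr_gt0.
have b_neq0 : b != 0 by rewrite gt_eqF.
have bb : b * b = a / 2 by rewrite -expr2 sqr_sqrtr // ltW // divr_gt0.
pose B i := b^-1 *: vc i; pose W := vanishing_orth X (R := R).
have WB i : W (B i).
  have [Hi orth_i] := coord_cochain_orth i; split; last first.
    by move=> h Hh; rewrite dotcZl orth_i ?mulr0.
  have [S SP] := homology1_equations R X0.
  by apply/SP => c cS; rewrite dotcZr; move/SP: Hi => /(_ _ cS) ->; rewrite mulr0.
have BB i j : dotc (B i) (B j) = (i == j)%:R.
  rewrite dotcZl dotcZr mulrA -invfM bb /dotc.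
  under eq_bigr => e _ do rewrite !ffunE.
  rewrite aP -[a *+ _]mulr_natr; set t := (i == j)%:R.
  by field; rewrite gt_eqF.
have spanW f : W f -> exists c : 'I_d -> R, f = \sum_i c i *: B i.
  move=> /vanishing_orth_coord [c ->]; exists (fun i => c i * b).
  by apply: eq_bigr => i _; rewrite scalerA mulfK.
have WE : W = lin_span (range B).
  apply/seteqP; split=> [f /spanW [c ->]|_ [n [c [h [hB ->]]]]].
    by exists d, c, B; split=> // i; exists i.
  have Wh i : W (h i) by have [j _ <-] := hB i.
  split; last first.
    move=> k Hk; rewrite dotc_suml big1 // => i _.
    by rewrite dotcZl; have [_ /(_ _ Hk) ->] := Wh i; rewrite mulr0.
  have [S SP] := homology1_equations R X0.
  apply/SP => k kS; rewrite dotc_sumr big1 // => i _.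
  by rewrite dotcZr; have [/SP /(_ _ kS) ->] := Wh i; rewrite mulr0.
have projE f i : dotc (B i) (orth_proj W f) = dotc (B i) f.
  pose w := \sum_j dotc f (B j) *: B j.
  have Ww : W w by rewrite WE; exists d, (fun j => dotc f (B j)), B; split=> // j; exists j.
  have [|_ projf] := orth_projP (f := f) Ww; last by rewrite dotcC projf // dotcC.
  move=> _ /spanW [c ->]; rewrite dotc_sumr big1 // => j _.
  rewrite dotcZr dotcBl dotc_suml (bigD1 j) //= dotcZl BB eqxx mulr1.
  rewrite big1 ?addr0 ?subrr ?mulr0 // => k /negPf kj.
  by rewrite dotcZl BB kj mulr0.
exists (fun x => b^-1 *: Phi x), b, 1%:M, 0; split=> //.
- exists B; split; first by split.
  move=> e; apply/matrixP => i j; rewrite ord1 [RHS]mxE projE dotcC.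
  have [_ ->] := v0P R X0 (tc_pe e); last by case: (WB i).
  rewrite /building_cochain -scalerBr [LHS]mxE !ffunE.
  by rewrite base_cochainE.
- by rewrite /orthogonal_mx trmx1 mulmx1.
- by move=> x; rewrite mul1mx addr0 scalerA divff // scale1r.
Qed.

End Realization.

Theorem theorem7p2 (R : realType) (V0 E0 : finType) (X0 : graph V0 E0)
    (X0_connected : connected_graph X0) (X0_degree : degree_ge X0 3)
    (d : nat) (X : topological_crystal X0 d)
    (rho : {additive tc_L X -> 'cV[R]_d}) (Phi : tc_V X -> 'cV[R]_d)
    (Phi_periodic : periodic_realization rho Phi)
    (Phi_injective : injective_realization Phi)
    (Gamma : set ('M[R]_d * 'cV[R]_d))
    (Gamma_group : congruence_group Gamma)
    (Gamma_preserves : preserves Gamma (realization_image Phi))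
    (Gamma_translations : contains_translations Gamma (range rho)) :
  crystallographic_group Gamma /\
  (irreducible_action (point_group Gamma) ->
   (forall x : tc_V X, fixed_vectors (isotropy Gamma (Phi x)) = [set 0]) ->
   standard_realization Phi).
Proof.
split; first exact: (Gamma_crystallographic X0_degree Phi_periodic).
move=> irr fix0.
have harmonic x0 :
    \sum_(e0 | org X0 e0 == x0) base_cochain Phi e0 = 0.
  have [x <-] := tc_p_surj X x0.
  exact: (isotropy_harmonic X0_degree Phi_periodic Phi_injective Gamma_group).
have [a a0 aP] := tight_frame X0_degree Phi_periodic Phi_injective Gamma_group
  Gamma_preserves Gamma_translations irr.
exact: (tight_harmonic_standard Phi_periodic harmonic a0 aP).
Qed.
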